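(* Let $\alpha: I\to\mathbb{R}^3$ be a general helix parametrized by arc-length $s$, with nowhere vanishing curvature, unit tangent vector $T$ and unit binormal vector $B$. Let $\sigma=\int_0^s\|T'(s)\|\,ds$ be the arc-length parameter of the tangent indicatrix of $\alpha$, and regard $T$ and $B$ as functions of $\sigma$. Let $a,\theta$ be constant real numbers (with $\cot\theta$ defined), let $c\in\mathbb{R}^3$ be a constant vector, and let $\sigma_0$ be a fixed parameter value. Then $$\tilde\gamma_T(\sigma)=a\int_{\sigma_0}^{\sigma}T(\sigma)\,d\sigma+a\cot\theta\int_{\sigma_0}^{\sigma}B(\sigma)\,d\sigma+c$$ is both a Bertrand curve and a circular helix.
   Context: For a unit speed curve $\alpha$ in $\mathbb{R}^3$: $T=\alpha'$, the curvature is $\kappa=\|\alpha''\|$, and where $\kappa\neq0$ the unit principal normal $N$ is defined by $\alpha''=\kappa N$ and the unit binormal is $B=T\times N$. The torsion $\tau$ is defined by the Frenet-Serret formulae $T'=\kappa N$, $N'=-\kappa T+\tau B$, $B'=-\tau N$. The tangent indicatrix $(T)$ is the curve on the unit sphere $\mathbb{S}^2$ traced by $T(s)$. A general helix is a curve whose unit tangent makes a constant angle with a fixed direction: there is a constant vector $u$ such that $T\cdot u=\cos\phi$ is constant along the curve; by Lancret's theorem this holds iff $\kappa/\tau$ is constant, where $\tau\ne0$. A circular helix is a curve for which both $\kappa$ and $\tau$ are non-zero constants. Convention: curves are regular and, wherever the Frenet frame is used, have nowhere vanishing curvature; this applies also to the curve $\tilde\gamma_T$ (i.e. $a,\theta$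 are such that it is a regular curve with nonvanishing curvature). A Bertrand curve is a curve in $\mathbb{R}^3$ which shares its principal normals with another curve (its Bertrand mate). The characterization used in the paper: a curve with curvature $\kappa$ and torsion $\tau$ is a Bertrand curve if and only if there exist non-zero real numbers $A,B$ such that $A\kappa+B\tau=1$ at every parameter value.
   Formalization: The circular-helix claim is proved under the added condition that τ + κ cot θ is non-zero at some point of I; otherwise the curve has zero torsion (an arc of a circle) and is not a circular helix, while the Bertrand claim holds without this condition. *)

(* Defs.v *)
From Stdlib Require Import Reals.
From Coquelicot Require Import Coquelicot.
Open Scope R_scope.

Definition vec : Type := (R * R * R)%type.

Definition vx (v : vec) : R := fst (fst v).
Definition vy (v : vec) : R := snd (fst v).
Definition vz (v : vec) : R := snd v.

Definition vadd (v w : vec) : vec := (vx v + vx w, vy v + vy w, vz v + vz w).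
Definition vscal (k : R) (v : vec) : vec := (k * vx v, k * vy v, k * vz v).
Definition dot (v w : vec) : R := vx v * vx w + vy v * vy w + vz v * vz w.
Definition cross (v w : vec) : vec :=
  (vy v * vz w - vz v * vy w,
   vz v * vx w - vx v * vz w,
   vx v * vy w - vy v * vx w).
Definition vnorm (v : vec) : R := sqrt (dot v v).

Definition vDerive (F : R -> vec) (t : R) : vec :=
  (Derive (fun u => vx (F u)) t,
   Derive (fun u => vy (F u)) t,
   Derive (fun u => vz (F u)) t).

Definition vRInt (F : R -> vec) (p q : R) : vec :=
  (RInt (fun u => vx (F u)) p q,
   RInt (fun u => vy (F u)) p q,
   RInt (fun u => vz (F u)) p q).

(* The Frenet apparatus of a curve in an arbitrary regular parametrization t.
   Curvature, normal, binormal and torsion are defined through the arc-length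
   parameter r; since dr/dt = speed, differentiation along the curve with
   respect to r is (1 / speed) d/dt. For a unit speed curve this is the ordinary
   derivative. *)
Definition speed (g : R -> vec) (t : R) : R := vnorm (vDerive g t).

Definition arcDerive (g F : R -> vec) (t : R) : vec :=
  vscal (/ speed g t) (vDerive F t).

Definition tangent (g : R -> vec) : R -> vec := arcDerive g g.

Definition curvature (g : R -> vec) (t : R) : R :=
  vnorm (arcDerive g (tangent g) t).

Definition normal (g : R -> vec) (t : R) : vec :=
  vscal (/ curvature g t) (arcDerive g (tangent g) t).

Definition binormal (g : R -> vec) (t : R) : vec :=
  cross (tangent g t) (normal g t).

(* The coefficient in the Frenet formula B' = - tau N, N being a unit vector. *)
Definition torsion (g : R -> vec) (t : R) : R :=
  - dot (arcDerive g (binormal g) t) (normal g t).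

(* Curves are restricted to a parameter domain J : R -> Prop; values outside J
   are irrelevant. *)
Definition open_interval (J : R -> Prop) : Prop :=
  (exists t, J t) /\ open J /\
  (forall p q r, J p -> J r -> p <= q <= r -> J q).

Definition C3_on (J : R -> Prop) (f : R -> R) : Prop :=
  forall t, J t ->
    (forall k : nat, (k <= 3)%nat -> ex_derive_n f k t) /\
    continuous (Derive_n f 3) t.

Definition regular_on (J : R -> Prop) (g : R -> vec) : Prop :=
  forall t, J t -> speed g t <> 0.

Definition curved_on (J : R -> Prop) (g : R -> vec) : Prop :=
  forall t, J t -> curvature g t <> 0.

Definition frenet_curve (J : R -> Prop) (g : R -> vec) : Prop :=
  open_interval J /\
  C3_on J (fun t => vx (g t)) /\
  C3_on J (fun t => vy (g t)) /\
  C3_on J (fun t => vz (g t)) /\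
  regular_on J g /\ curved_on J g.

Definition unit_speed (J : R -> Prop) (g : R -> vec) : Prop :=
  forall t, J t -> speed g t = 1.

Definition general_helix (J : R -> Prop) (g : R -> vec) : Prop :=
  frenet_curve J g /\
  exists (u : vec) (phi : R),
    vnorm u = 1 /\ forall t, J t -> dot (tangent g t) u = cos phi.

Definition circular_helix (J : R -> Prop) (g : R -> vec) : Prop :=
  frenet_curve J g /\
  exists k w : R, k <> 0 /\ w <> 0 /\
    forall t, J t -> curvature g t = k /\ torsion g t = w.

Definition principal_normal_line (g : R -> vec) (t : R) (p : vec) : Prop :=
  exists x : R, p = vadd (g t) (vscal x (normal g t)).

(* The mate is another curve: corresponding points are distinct, which keeps a
   curve from being its own mate under the identity correspondence. *)
Definition bertrand_mate (J : R -> Prop) (g h : R -> vec) : Prop :=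
  frenet_curve J h /\
  forall t, J t ->
    h t <> g t /\
    forall p, principal_normal_line g t p <-> principal_normal_line h t p.

Definition bertrand_curve (J : R -> Prop) (g : R -> vec) : Prop :=
  frenet_curve J g /\ exists h : R -> vec, bertrand_mate J g h.

Definition indicatrix_arclength (g : R -> vec) (t : R) : R :=
  RInt (fun u => vnorm (vDerive (tangent g) u)) 0 t.

Definition indicatrix_domain (J : R -> Prop) (g : R -> vec) (sigma : R) : Prop :=
  exists t, J t /\ indicatrix_arclength g t = sigma.

Definition cot (theta : R) : R := cos theta / sin theta.

(* T and B become functions of sigma by composition with s = s(sigma), the
   inverse of the indicatrix arc length. *)
Definition gamma_T (g : R -> vec) (s : R -> R) (a theta sigma0 : R) (c : vec)
    (sigma : R) : vec :=
  vadd
    (vadd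
       (vscal a (vRInt (fun u => tangent g (s u)) sigma0 sigma))
       (vscal (a * cot theta) (vRInt (fun u => binormal g (s u)) sigma0 sigma)))
    c.

(* Main.v *)
(* For a general helix, tau = m kappa with m constant. In the arc length of the
   tangent indicatrix the Frenet frame therefore satisfies the linear system
   T' = N, N' = - T + m B, B' = - m N with constant coefficients. A curve whose
   derivative is x T + y B with x, y constant and x <> m y has constant speed,
   principal normal N or - N, constant curvature |x - m y| / (x^2 + y^2) and
   constant torsion (m x + y) / (x^2 + y^2). This applies to gamma_T, with x = a
   and y = a cot theta, and also to the curve gamma_T + mu N for a suitable
   constant mu <> 0, which is then a Bertrand mate. *)
Require Import Defs.
From Stdlib Require Import Reals Lra Lia.
From Coquelicot Require Import Coquelicot.
Open Scope R_scope.

(** * Derivatives of real-valued and vector-valued functions *)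

Lemma is_derive_eq (f : R -> R) (t l l' : R) :
  is_derive f t l -> l = l' -> is_derive f t l'.
Proof. now intros H <-. Qed.

Lemma is_derive_Rplus (f g : R -> R) (t df dg : R) :
  is_derive f t df -> is_derive g t dg ->
  is_derive (fun u => f u + g u) t (df + dg).
Proof. intros Hf Hg; exact (is_derive_plus f g t df dg Hf Hg). Qed.

Lemma is_derive_Rminus (f g : R -> R) (t df dg : R) :
  is_derive f t df -> is_derive g t dg ->
  is_derive (fun u => f u - g u) t (df - dg).
Proof. intros Hf Hg; exact (is_derive_minus f g t df dg Hf Hg). Qed.

Lemma is_derive_Rmult (f g : R -> R) (t df dg : R) :
  is_derive f t df -> is_derive g t dg ->
  is_derive (fun u => f u * g u) t (df * g t + f t * dg).
Proof. intros Hf Hg; exact (is_derive_mult f g t df dg Hf Hg Rmult_comm). Qed.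

Lemma is_derive_continuous (f : R -> R) (t l : R) :
  is_derive f t l -> continuous f t.
Proof. intros H; apply (ex_derive_continuous (V := R_NormedModule)); now exists l. Qed.

Lemma is_derive_ext_on (J : R -> Prop) (f g : R -> R) (t l : R) :
  open J -> J t -> (forall u, J u -> f u = g u) -> is_derive f t l -> is_derive g t l.
Proof.
intros HJ Jt E; apply is_derive_ext_loc.
apply (filter_imp J); [exact E | exact (HJ t Jt)].
Qed.

Lemma vec_eq (v w : vec) : vx v = vx w -> vy v = vy w -> vz v = vz w -> v = w.
Proof.
destruct v as [[? ?] ?], w as [[? ?] ?]; unfold vx, vy, vz; simpl.
now intros -> -> ->.
Qed.

Ltac vec_ring :=
  apply vec_eq; unfold vadd, vscal, cross, dot, vx, vy, vz; simpl; ring.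

(** [vDerive] is total and has a value even where a component is not differentiable; this relation
    asserts differentiability as well as the value. *)
Definition is_vDerive (F : R -> vec) (t : R) (V : vec) : Prop :=
  is_derive (fun u => vx (F u)) t (vx V) /\
  is_derive (fun u => vy (F u)) t (vy V) /\
  is_derive (fun u => vz (F u)) t (vz V).

Lemma is_vDerive_unique (F : R -> vec) (t : R) (V : vec) :
  is_vDerive F t V -> vDerive F t = V.
Proof.
intros [H1 [H2 H3]]; apply vec_eq; unfold vDerive, vx, vy, vz; simpl;
  now apply is_derive_unique.
Qed.

Lemma is_vDerive_eq (F : R -> vec) (t : R) (V W : vec) :
  is_vDerive F t V -> V = W -> is_vDerive F t W.
Proof. now intros H <-. Qed.

Lemma is_vDerive_ext_on (J : R -> Prop) (F G : R -> vec) (t : R) (V : vec) :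
  open J -> J t -> (forall u, J u -> F u = G u) ->
  is_vDerive F t V -> is_vDerive G t V.
Proof.
intros HJ Jt E [H1 [H2 H3]].
split; [| split]; (eapply is_derive_ext_on; [exact HJ | exact Jt | | eassumption]; simpl);
  intros u Ju; now rewrite (E u Ju).
Qed.

Lemma is_vDerive_add (F G : R -> vec) (t : R) (V W : vec) :
  is_vDerive F t V -> is_vDerive G t W ->
  is_vDerive (fun u => vadd (F u) (G u)) t (vadd V W).
Proof.
intros [H1 [H2 H3]] [K1 [K2 K3]].
split; [| split]; [exact (is_derive_Rplus _ _ t _ _ H1 K1)
  | exact (is_derive_Rplus _ _ t _ _ H2 K2) | exact (is_derive_Rplus _ _ t _ _ H3 K3)].
Qed.

Lemma is_vDerive_const (V : vec) (t : R) : is_vDerive (fun _ => V) t (0, 0, 0).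
Proof. split; [| split]; exact (is_derive_const (V := R_NormedModule) _ t). Qed.


Lemma is_vDerive_scal (k : R -> R) (F : R -> vec) (t dk : R) (V : vec) :
  is_derive k t dk -> is_vDerive F t V ->
  is_vDerive (fun u => vscal (k u) (F u)) t (vadd (vscal dk (F t)) (vscal (k t) V)).
Proof.
intros Hk [H1 [H2 H3]].
split; [| split]; [exact (is_derive_Rmult k _ t _ _ Hk H1)
  | exact (is_derive_Rmult k _ t _ _ Hk H2) | exact (is_derive_Rmult k _ t _ _ Hk H3)].
Qed.

Lemma is_vDerive_scal_const (k : R) (F : R -> vec) (t : R) (V : vec) :
  is_vDerive F t V -> is_vDerive (fun u => vscal k (F u)) t (vscal k V).
Proof.
intros [H1 [H2 H3]].
split; [| split]; [exact (is_derive_scal _ t k _ H1)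
  | exact (is_derive_scal _ t k _ H2) | exact (is_derive_scal _ t k _ H3)].
Qed.

Lemma is_derive_dot (F G : R -> vec) (t : R) (V W : vec) :
  is_vDerive F t V -> is_vDerive G t W ->
  is_derive (fun u => dot (F u) (G u)) t (dot V (G t) + dot (F t) W).
Proof.
intros [H1 [H2 H3]] [K1 [K2 K3]].
eapply is_derive_eq.
- exact (is_derive_Rplus _ _ t _ _ (is_derive_Rplus _ _ t _ _
    (is_derive_Rmult _ _ t _ _ H1 K1) (is_derive_Rmult _ _ t _ _ H2 K2))
    (is_derive_Rmult _ _ t _ _ H3 K3)).
- unfold dot; ring.
Qed.

Lemma is_vDerive_cross (F G : R -> vec) (t : R) (V W : vec) :
  is_vDerive F t V -> is_vDerive G t W ->
  is_vDerive (fun u => cross (F u) (G u)) t (vadd (cross V (G t)) (cross (F t) W)).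
Proof.
intros [H1 [H2 H3]] [K1 [K2 K3]].
split; [| split]; eapply is_derive_eq.
- exact (is_derive_Rminus _ _ t _ _
    (is_derive_Rmult _ _ t _ _ H2 K3) (is_derive_Rmult _ _ t _ _ H3 K2)).
- unfold vadd, cross, vx, vy, vz; simpl; ring.
- exact (is_derive_Rminus _ _ t _ _
    (is_derive_Rmult _ _ t _ _ H3 K1) (is_derive_Rmult _ _ t _ _ H1 K3)).
- unfold vadd, cross, vx, vy, vz; simpl; ring.
- exact (is_derive_Rminus _ _ t _ _
    (is_derive_Rmult _ _ t _ _ H1 K2) (is_derive_Rmult _ _ t _ _ H2 K1)).
- unfold vadd, cross, vx, vy, vz; simpl; ring.
Qed.

Lemma is_vDerive_comp (F : R -> vec) (s : R -> R) (t ds : R) (V : vec) :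
  is_vDerive F (s t) V -> is_derive s t ds ->
  is_vDerive (fun u => F (s u)) t (vscal ds V).
Proof.
intros [H1 [H2 H3]] Hs.
split; [| split];
  [ exact (is_derive_comp (fun u => vx (F u)) s t _ _ H1 Hs)
  | exact (is_derive_comp (fun u => vy (F u)) s t _ _ H2 Hs)
  | exact (is_derive_comp (fun u => vz (F u)) s t _ _ H3 Hs) ].
Qed.

(** Turns the orthonormality relations along a curve into relations between derivatives. *)
Lemma is_derive_const_on (J : R -> Prop) (f : R -> R) (k t l : R) :
  open J -> J t -> (forall u, J u -> f u = k) -> is_derive f t l -> l = 0.
Proof.
intros HJ Jt E H.
apply (is_derive_ext_on J f (fun _ => k)) in H; auto.
apply is_derive_unique in H; rewrite <- H; apply Derive_const.
Qed.

(** * Mean value theorem and integrals on an open interval *)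

Lemma interval_between (J : R -> Prop) (p q r : R) :
  Defs.open_interval J -> J p -> J q -> Rmin p q <= r <= Rmax p q -> J r.
Proof.
intros [_ [_ H]] Jp Jq; unfold Rmin, Rmax; destruct (Rle_dec p q); intros Hr.
- now apply (H p r q).
- now apply (H q r p).
Qed.

Lemma mean_value_on (J : R -> Prop) (f df : R -> R) (p q : R) :
  Defs.open_interval J -> (forall u, J u -> is_derive f u (df u)) -> J p -> J q ->
  exists c, J c /\ f q - f p = df c * (q - p).
Proof.
intros HJ H Jp Jq.
destruct (MVT_gen f p q df) as [c [Hc E]].
- intros x Hx; apply H, (interval_between J p q); auto; lra.
- intros x Hx; apply continuity_pt_filterlim.
  apply (is_derive_continuous f x (df x)), H, (interval_between J p q); auto.
- exists c; split; [now apply (interval_between J p q) | exact E].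
Qed.

(** Integrability from [p] to every [x] near [t] holds because [J] is open and contains the segment
    between any two of its points. *)
Lemma is_derive_RInt_on (J : R -> Prop) (f : R -> R) (p t : R) :
  Defs.open_interval J -> (forall u, J u -> continuous f u) -> J p -> J t ->
  is_derive (fun x => RInt f p x) t (f t).
Proof.
intros HJ C Jp Jt.
apply (is_derive_RInt (V := R_NormedModule) f _ p t); [| now apply C].
apply (filter_imp J); [| exact (proj1 (proj2 HJ) t Jt)].
intros x Jx; apply (RInt_correct (V := R_CompleteNormedModule)).
apply (ex_RInt_continuous (V := R_CompleteNormedModule)).
intros z Hz; apply C, (interval_between J p x); auto.
Qed.

Lemma is_vDerive_vRInt (J : R -> Prop) (F : R -> vec) (p t : R) :
  Defs.open_interval J -> (forall u, J u -> exists V, is_vDerive F u V) -> J p -> J t ->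
  is_vDerive (fun x => vRInt F p x) t (F t).
Proof.
intros HJ H Jp Jt.
split; [| split]; apply (is_derive_RInt_on J (fun u => _ (F u))); auto;
  intros u Ju; destruct (H u Ju) as [V [H1 [H2 H3]]]; eapply is_derive_continuous; eassumption.
Qed.

(** * Inverse of a function with positive derivative *)

Section Inverse.

Variables (I : R -> Prop) (f df g : R -> R).
Hypothesis I_interval : Defs.open_interval I.
Hypothesis f_derive : forall t, I t -> is_derive f t (df t).
Hypothesis df_pos : forall t, I t -> 0 < df t.
Hypothesis fK : forall t, I t -> g (f t) = t.

Lemma increasing_on (p q : R) : I p -> I q -> p < q -> f p < f q.
Proof.
intros Ip Iq pq.
destruct (mean_value_on I f df p q) as [c [Ic E]]; auto.
generalize (df_pos c Ic); intros; nra.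
Qed.

Lemma intermediate_on (p q y : R) :
  I p -> I q -> p < q -> f p < y < f q -> exists t, p < t < q /\ I t /\ f t = y.
Proof.
intros Ip Iq pq Hy.
assert (C : forall x, p <= x <= q -> continuity_pt f x).
{ intros x Hx; apply continuity_pt_filterlim.
  apply (is_derive_continuous f x (df x)), f_derive.
  now apply (proj2 (proj2 I_interval) p x q). }
destruct (IVT_Rbar_incr f p q (f p) (f q) y) as [t [H1 [H2 H3]]].
- apply is_lim_continuity, C; lra.
- apply is_lim_continuity, C; lra.
- simpl; intros x H1 H2; apply C; lra.
- exact pq.
- exact Hy.
- simpl in H1, H2; exists t; repeat split; auto.
  apply (proj2 (proj2 I_interval) p t q); auto; lra.
Qed.

(** For small [e], the values at [t - e] and [t + e] lie strictly on either side of [f t], and the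
    intermediate value theorem fills the gap. This gives at once openness of the image and
    continuity of the inverse. *)
Lemma inverse_near (t eps : R) :
  I t -> 0 < eps ->
  exists delta, 0 < delta /\
    forall y, Rabs (y - f t) < delta ->
      exists u, I u /\ f u = y /\ Rabs (u - t) < eps.
Proof.
intros It Heps.
destruct (proj1 (proj2 I_interval) t It) as [d Hd].
set (e := Rmin eps d / 2).
assert (He : 0 < e < eps /\ e < d).
{ unfold e, Rmin; generalize (cond_pos d); destruct (Rle_dec eps d); lra. }
assert (Im : I (t - e)).
{ apply Hd; change (Rabs (t - e - t) < d); apply Rabs_def1; lra. }
assert (Ip : I (t + e)).
{ apply Hd; change (Rabs (t + e - t) < d); apply Rabs_def1; lra. }
assert (L1 : f (t - e) < f t) by (apply increasing_on; auto; lra).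
assert (L2 : f t < f (t + e)) by (apply increasing_on; auto; lra).
exists (Rmin (f t - f (t - e)) (f (t + e) - f t)); split.
{ apply Rmin_glb_lt; lra. }
intros y Hy.
assert (Hy' : f (t - e) < y < f (t + e)).
{ generalize (Rmin_l (f t - f (t - e)) (f (t + e) - f t))
    (Rmin_r (f t - f (t - e)) (f (t + e) - f t)).
  apply Rabs_def2 in Hy; lra. }
destruct (intermediate_on (t - e) (t + e) y) as [u [H1 [H2 H3]]]; auto; [lra |].
exists u; repeat split; auto; apply Rabs_def1; lra.
Qed.

(** Applied to the indicatrix arc length, this makes the range of sigma an admissible parameter
    domain. *)
Lemma image_open_interval : Defs.open_interval (fun y => exists t, I t /\ f t = y).
Proof.
split; [| split].
- destruct (proj1 I_interval) as [t It]; now exists (f t), t.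
- intros y [t [It <-]].
  destruct (inverse_near t 1 It Rlt_0_1) as [d [Hd H]].
  exists (mkposreal d Hd); intros z Hz.
  destruct (H z Hz) as [u [Iu [E _]]]; now exists u.
- intros y1 y y2 [t1 [I1 E1]] [t2 [I2 E2]] [L1 L2].
  destruct (Req_dec y1 y) as [<- | N1]; [now exists t1 |].
  destruct (Req_dec y y2) as [-> | N2]; [now exists t2 |].
  destruct (Rlt_le_dec t1 t2) as [L | L].
  + destruct (intermediate_on t1 t2 y) as [t [_ Ht]]; auto; [lra |].
    now exists t.
  + destruct L as [L | ->]; [| lra].
    generalize (increasing_on t2 t1 I2 I1 L); lra.
Qed.

(* The difference quotient of [g] at [f t] is the inverse of that of [f] at [t]. *)
Lemma is_derive_inverse (t : R) : I t -> is_derive g (f t) (/ df t).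
Proof.
intros It.
apply is_derive_Reals; intros eps Heps.
assert (Hp := df_pos t It).
(* Continuity of the reciprocal at [df t] converts the tolerance [eps] for the quotient of [g] into
   a tolerance [e1] for that of [f]. *)
assert (C : continuous Rinv (df t)).
{ apply continuity_pt_filterlim.
  apply (continuity_pt_inv (fun x => x)); [apply continuity_pt_id | lra]. }
destruct (C (ball (/ df t) (mkposreal eps Heps)) (locally_ball _ _)) as [e1 He1].
assert (Hf := proj1 (is_derive_Reals _ _ _) (f_derive t It) e1 (cond_pos e1)).
destruct Hf as [e2 He2].
destruct (inverse_near t e2 It (cond_pos e2)) as [d [Hd H]].
exists (mkposreal d Hd); intros h Hh0 Hh; simpl in Hh.
destruct (H (f t + h)) as [u [Iu [E Hu]]].
{ now replace (f t + h - f t) with h by ring. }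
rewrite <- E, !fK by assumption.
assert (Nu : u - t <> 0).
{ intros Z; replace u with t in E by lra; lra. }
assert (Q := He2 (u - t) Nu Hu).
replace (t + (u - t)) with u in Q by ring.
assert (R := He1 _ Q).
replace ((u - t) / h) with (/ ((f u - f t) / (u - t))); [exact R |].
replace (f u - f t) with h by lra.
now field.
Qed.

End Inverse.

(** * Curves with constant coordinates in a helix frame *)

(** [Derive_n f k] is known to agree with the given derivative only on [J], so each agreement is
    transferred through a neighbourhood inside [J] before the next differentiation. *)
Lemma C3_on_intro (J : R -> Prop) (f f1 f2 f3 : R -> R) :
  open J ->
  (forall t, J t -> is_derive f t (f1 t)) ->
  (forall t, J t -> is_derive f1 t (f2 t)) ->
  (forall t, J t -> is_derive f2 t (f3 t)) ->
  (forall t, J t -> continuous f3 t) ->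
  C3_on J f.
Proof.
intros HJ H1 H2 H3 C.
assert (D1 : forall t, J t -> Derive_n f 1 t = f1 t).
{ intros t Jt; apply is_derive_unique, H1, Jt. }
assert (K2 : forall t, J t -> is_derive (Derive_n f 1) t (f2 t)).
{ intros t Jt; apply (is_derive_ext_on J f1); auto; intros; now rewrite D1. }
assert (D2 : forall t, J t -> Derive_n f 2 t = f2 t).
{ intros t Jt; apply is_derive_unique, K2, Jt. }
assert (K3 : forall t, J t -> is_derive (Derive_n f 2) t (f3 t)).
{ intros t Jt; apply (is_derive_ext_on J f2); auto; intros; now rewrite D2. }
assert (D3 : forall t, J t -> Derive_n f 3 t = f3 t).
{ intros t Jt; apply is_derive_unique, K3, Jt. }
intros t Jt; split.
- intros [| [| [| [| k]]]] Hk; [exact Logic.I | | | | lia].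
  + now exists (f1 t); apply H1.
  + now exists (f2 t); apply K2.
  + now exists (f3 t); apply K3.
- eapply continuous_ext_loc; [| now apply C].
  apply (filter_imp J); [| exact (HJ t Jt)].
  intros u Ju; now rewrite D3.
Qed.

(** The fourth derivative [F4] serves to make [F3] continuous. *)
Lemma C3_on_components (J : R -> Prop) (F F1 F2 F3 F4 : R -> vec) :
  open J ->
  (forall t, J t -> is_vDerive F t (F1 t)) ->
  (forall t, J t -> is_vDerive F1 t (F2 t)) ->
  (forall t, J t -> is_vDerive F2 t (F3 t)) ->
  (forall t, J t -> is_vDerive F3 t (F4 t)) ->
  C3_on J (fun t => vx (F t)) /\ C3_on J (fun t => vy (F t)) /\
  C3_on J (fun t => vz (F t)).
Proof.
intros HJ H H1 H2 H3.
split; [| split].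
- exact (C3_on_intro J _ (fun t => vx (F1 t)) (fun t => vx (F2 t)) (fun t => vx (F3 t)) HJ
    (fun t Jt => proj1 (H t Jt)) (fun t Jt => proj1 (H1 t Jt))
    (fun t Jt => proj1 (H2 t Jt))
    (fun t Jt => is_derive_continuous _ t _ (proj1 (H3 t Jt)))).
- exact (C3_on_intro J _ (fun t => vy (F1 t)) (fun t => vy (F2 t)) (fun t => vy (F3 t)) HJ
    (fun t Jt => proj1 (proj2 (H t Jt))) (fun t Jt => proj1 (proj2 (H1 t Jt)))
    (fun t Jt => proj1 (proj2 (H2 t Jt)))
    (fun t Jt => is_derive_continuous _ t _ (proj1 (proj2 (H3 t Jt))))).
- exact (C3_on_intro J _ (fun t => vz (F1 t)) (fun t => vz (F2 t)) (fun t => vz (F3 t)) HJ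
    (fun t Jt => proj2 (proj2 (H t Jt))) (fun t Jt => proj2 (proj2 (H1 t Jt)))
    (fun t Jt => proj2 (proj2 (H2 t Jt)))
    (fun t Jt => is_derive_continuous _ t _ (proj2 (proj2 (H3 t Jt))))).
Qed.

Lemma C3_on_derivatives (J : R -> Prop) (f : R -> R) (t : R) :
  C3_on J f -> J t ->
  is_derive f t (Derive f t) /\
  is_derive (Derive f) t (Derive (Derive f) t) /\
  is_derive (Derive (Derive f)) t (Derive (Derive (Derive f)) t).
Proof.
intros H Jt; destruct (H t Jt) as [K _].
split; [| split]; apply Derive_correct.
- apply (K 1%nat); lia.
- apply (K 2%nat); lia.
- apply (K 3%nat); lia.
Qed.

(* The Frenet equations of a curve whose torsion is [m] times its curvature, in
   the arc length of the tangent indicatrix. *)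
Definition helix_frame (J : R -> Prop) (m : R) (T N B : R -> vec) : Prop :=
  forall t, J t ->
    dot (T t) (T t) = 1 /\ dot (N t) (N t) = 1 /\ dot (T t) (N t) = 0 /\
    B t = cross (T t) (N t) /\
    is_vDerive T t (N t) /\
    is_vDerive N t (vadd (vscal (-1) (T t)) (vscal m (B t))) /\
    is_vDerive B t (vscal (- m) (N t)).

(** The squared length of [cross T N] comes from Lagrange's identity. *)
Lemma dot_frame (T N : vec) (x y z : R) :
  dot T T = 1 -> dot N N = 1 -> dot T N = 0 ->
  let V := vadd (vadd (vscal x T) (vscal y (cross T N))) (vscal z N) in
  dot V V = x * x + y * y + z * z.
Proof.
intros HT HN H V.
transitivity (x * x * dot T T + y * y * (dot T T * dot N N - dot T N * dot T N)
  + z * z * dot N N + 2 * x * z * dot T N).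
- unfold V, vadd, vscal, cross, dot, vx, vy, vz; simpl; ring.
- rewrite HT, HN, H; ring.
Qed.

Lemma vnorm_scal_unit (k : R) (V : vec) : dot V V = 1 -> vnorm (vscal k V) = Rabs k.
Proof.
intros H; unfold vnorm.
replace (dot (vscal k V) (vscal k V)) with (k * k * dot V V)
  by (unfold dot, vscal, vx, vy, vz; simpl; ring).
rewrite H, Rmult_1_r; apply sqrt_Rsqr_abs.
Qed.

Lemma cross_binormal (T N : vec) :
  dot N N = 1 -> dot T N = 0 -> cross (cross T N) N = vscal (-1) T.
Proof.
intros HN H.
replace (cross (cross T N) N)
  with (vadd (vscal (dot T N) N) (vscal (- dot N N) T)) by vec_ring.
rewrite HN, H; vec_ring.
Qed.

Section FrameCurve.

Variables (J : R -> Prop) (m : R) (T N B : R -> vec).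
Variables (x y : R) (g : R -> vec).
Hypothesis J_interval : Defs.open_interval J.
Hypothesis frame : helix_frame J m T N B.
Hypothesis g_derive :
  forall t, J t -> is_vDerive g t (vadd (vscal x (T t)) (vscal y (B t))).

Let v := sqrt (x * x + y * y).
Let J_open : open J := proj1 (proj2 J_interval).

(** The derivatives of [T] and [B] are both multiples of [N], so any fixed combination of them turns
    in the direction of [N]. *)
Lemma frame_curve_derive2 (t : R) :
  J t ->
  is_vDerive (fun u => vadd (vscal x (T u)) (vscal y (B u))) t (vscal (x - m * y) (N t)).
Proof.
intros Jt; destruct (frame t Jt) as [_ [_ [_ [_ [H1 [_ H3]]]]]].
eapply is_vDerive_eq; [apply is_vDerive_add; apply is_vDerive_scal_const; eassumption |].
vec_ring.
Qed.

Lemma frame_curve_speed (t : R) : J t -> speed g t = v.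
Proof.
intros Jt; unfold speed; rewrite (is_vDerive_unique _ _ _ (g_derive t Jt)).
destruct (frame t Jt) as [H1 [H2 [H3 [H4 _]]]].
unfold vnorm, v; f_equal; rewrite H4.
replace (vadd (vscal x (T t)) (vscal y (cross (T t) (N t))))
  with (vadd (vadd (vscal x (T t)) (vscal y (cross (T t) (N t)))) (vscal 0 (N t)))
  by vec_ring.
rewrite dot_frame by assumption; ring.
Qed.

Lemma frame_curve_tangent (t : R) :
  J t -> tangent g t = vscal (/ v) (vadd (vscal x (T t)) (vscal y (B t))).
Proof.
intros Jt; unfold tangent, arcDerive.
now rewrite frame_curve_speed, (is_vDerive_unique _ _ _ (g_derive t Jt)).
Qed.

Lemma frame_curve_tangent_derive (t : R) :
  J t -> arcDerive g (tangent g) t = vscal (/ v * / v * (x - m * y)) (N t).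
Proof.
intros Jt; unfold arcDerive; rewrite frame_curve_speed by assumption.
rewrite (is_vDerive_unique _ t (vscal (/ v) (vscal (x - m * y) (N t)))); [vec_ring |].
eapply (is_vDerive_ext_on J); [exact J_open | exact Jt | |].
- intros u Ju; symmetry; exact (frame_curve_tangent u Ju).
- apply is_vDerive_scal_const, frame_curve_derive2, Jt.
Qed.

Lemma frame_curve_curvature (t : R) :
  J t -> curvature g t = Rabs (/ v * / v * (x - m * y)).
Proof.
intros Jt; unfold curvature; rewrite frame_curve_tangent_derive by assumption.
apply vnorm_scal_unit, (frame t Jt).
Qed.

(** Since [x], [y] and [m] are constants, the curvature at a single parameter settles nondegeneracy
    for the whole curve. *)
Lemma frame_curve_nondegenerate (t : R) : J t -> curvature g t <> 0 -> x - m * y <> 0.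
Proof.
intros Jt H E; apply H.
now rewrite frame_curve_curvature, E, Rmult_0_r, Rabs_R0.
Qed.

Hypothesis nondegenerate : x - m * y <> 0.

Lemma frame_curve_speed_pos : 0 < v.
Proof.
apply sqrt_lt_R0.
destruct (Req_dec x 0) as [Hx | Hx];
  [| generalize (Rsqr_pos_lt x Hx) (Rle_0_sqr y); unfold Rsqr; lra].
destruct (Req_dec y 0) as [Hy | Hy];
  [| generalize (Rsqr_pos_lt y Hy) (Rle_0_sqr x); unfold Rsqr; lra].
destruct nondegenerate; rewrite Hx, Hy; ring.
Qed.

(** The sign of [x - m * y]: it decides whether the principal normal is [N] or its opposite. *)
Let e := / Rabs (x - m * y) * (x - m * y).

Lemma frame_curve_sign : e * e = 1 /\ e <> 0.
Proof.
assert (A := Rabs_no_R0 _ nondegenerate).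
assert (E : e * e = 1).
{ assert (S : Rabs (x - m * y) * Rabs (x - m * y) = (x - m * y) * (x - m * y)).
  { rewrite <- Rabs_mult; apply Rabs_pos_eq, Rle_0_sqr. }
  unfold e; transitivity
    (/ Rabs (x - m * y) * / Rabs (x - m * y) * ((x - m * y) * (x - m * y))); [ring |].
  rewrite <- S; now field. }
split; [exact E | intros Z; rewrite Z in E; lra].
Qed.

Lemma frame_curve_normal (t : R) : J t -> normal g t = vscal e (N t).
Proof.
intros Jt; unfold normal.
rewrite frame_curve_curvature, frame_curve_tangent_derive by assumption.
assert (V := frame_curve_speed_pos).
assert (P : 0 < / v * / v) by (apply Rmult_lt_0_compat; now apply Rinv_0_lt_compat).
assert (A := Rabs_no_R0 _ nondegenerate).
replace e with (/ Rabs (/ v * / v * (x - m * y)) * (/ v * / v * (x - m * y))); [vec_ring |].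
rewrite Rabs_mult, (Rabs_pos_eq (/ v * / v)) by lra.
unfold e; field; split; [exact A | lra].
Qed.

Lemma frame_curve_binormal (t : R) :
  J t -> binormal g t = vscal (e * / v) (vadd (vscal x (B t)) (vscal (- y) (T t))).
Proof.
intros Jt; unfold binormal.
rewrite frame_curve_tangent, frame_curve_normal by assumption.
destruct (frame t Jt) as [H1 [H2 [H3 [-> _]]]].
transitivity (vscal (e * / v) (vadd (vscal x (cross (T t) (N t)))
  (vscal y (cross (cross (T t) (N t)) (N t))))); [vec_ring |].
rewrite cross_binormal by assumption; vec_ring.
Qed.

(** Up to the factor [e * / v] the binormal is [x B - y T], with derivative [- (m x + y) N]. Pairing
    with the normal [e N] brings a second [e], and [e * e = 1]. *)
Lemma frame_curve_torsion (t : R) :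
  J t -> torsion g t = / v * / v * (m * x + y).
Proof.
intros Jt; unfold torsion, arcDerive.
rewrite frame_curve_speed, frame_curve_normal by assumption.
destruct (frame t Jt) as [H1 [H2 [H3 [_ [K1 [_ K3]]]]]].
rewrite (is_vDerive_unique (binormal g) t (vscal (- (e * / v * (m * x + y))) (N t))).
- transitivity (e * e * (/ v * / v * (m * x + y)) * dot (N t) (N t)).
  + unfold dot, vscal, vx, vy, vz; simpl; ring.
  + rewrite H2, (proj1 frame_curve_sign); ring.
- eapply (is_vDerive_ext_on J); [exact J_open | exact Jt | |].
  + intros u Ju; symmetry; exact (frame_curve_binormal u Ju).
  + eapply is_vDerive_eq.
    * apply is_vDerive_scal_const, is_vDerive_add; apply is_vDerive_scal_const; eassumption.
    * vec_ring.
Qed.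

Lemma frame_curve_frenet : frenet_curve J g.
Proof.
assert (D2 := frame_curve_derive2).
assert (D3 : forall t, J t -> is_vDerive (fun u => vscal (x - m * y) (N u)) t
  (vscal (x - m * y) (vadd (vscal (-1) (T t)) (vscal m (B t))))).
{ intros t Jt; apply is_vDerive_scal_const, (frame t Jt). }
assert (D4 : forall t, J t -> is_vDerive
  (fun u => vscal (x - m * y) (vadd (vscal (-1) (T u)) (vscal m (B u)))) t
  (vscal (x - m * y) (vadd (vscal (-1) (N t)) (vscal m (vscal (- m) (N t)))))).
{ intros t Jt; destruct (frame t Jt) as [_ [_ [_ [_ [K1 [_ K3]]]]]].
  now apply is_vDerive_scal_const, is_vDerive_add; apply is_vDerive_scal_const. }
split; [exact J_interval |].
destruct (C3_on_components J g _ _ _ _ J_open g_derive D2 D3 D4) as [Cx [Cy Cz]].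
split; [exact Cx | split; [exact Cy | split; [exact Cz | split]]].
- intros t Jt; rewrite frame_curve_speed by assumption.
  apply Rgt_not_eq, frame_curve_speed_pos.
- intros t Jt; rewrite frame_curve_curvature by assumption.
  assert (V := Rinv_neq_0_compat v (Rgt_not_eq _ _ frame_curve_speed_pos)).
  apply Rabs_no_R0; repeat apply Rmult_integral_contrapositive_currified; assumption.
Qed.

Lemma frame_curve_circular_helix : m * x + y <> 0 -> circular_helix J g.
Proof.
intros H; split; [exact frame_curve_frenet |].
assert (V := Rinv_neq_0_compat v (Rgt_not_eq _ _ frame_curve_speed_pos)).
exists (Rabs (/ v * / v * (x - m * y))), (/ v * / v * (m * x + y)).
split; [| split].
- apply Rabs_no_R0; repeat apply Rmult_integral_contrapositive_currified; assumption.
- repeat apply Rmult_integral_contrapositive_currified; assumption.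
- intros t Jt; split; [now apply frame_curve_curvature | now apply frame_curve_torsion].
Qed.

End FrameCurve.

(** The principal normal differs from [N] by a non-zero factor only, whatever [x] and [y] are. Hence
    two such curves over the same frame have parallel normal lines at equal parameters. *)
Lemma frame_curve_normal_line (J : R -> Prop) (m : R) (T N B : R -> vec) (x y : R)
    (g : R -> vec) (t : R) (p : vec) :
  Defs.open_interval J -> helix_frame J m T N B ->
  (forall u, J u -> is_vDerive g u (vadd (vscal x (T u)) (vscal y (B u)))) ->
  x - m * y <> 0 -> J t ->
  principal_normal_line g t p <-> exists z, p = vadd (g t) (vscal z (N t)).
Proof.
intros HJ HF Hg Hn Jt; unfold principal_normal_line.
rewrite (frame_curve_normal J m T N B x y g HJ HF Hg Hn t Jt).
assert (E := proj2 (frame_curve_sign m x y Hn)).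
set (e := / Rabs (x - m * y) * (x - m * y)) in *.
split; intros [z ->].
- exists (z * e); vec_ring.
- exists (z / e); unfold Rdiv.
  replace (vscal z (N t)) with (vscal (z * / e * e) (N t)); [vec_ring |].
  f_equal; now field.
Qed.

(* Along the mate [g + mu N] the derivative is again a fixed combination
   [x' T + y' B]; with this [mu], [x' - m y'] is [-(x - m y)], so that the mate
   is never degenerate, even when [g] is a circle. *)
Lemma frame_curve_bertrand (J : R -> Prop) (m : R) (T N B : R -> vec) (x y : R)
    (g : R -> vec) :
  Defs.open_interval J -> helix_frame J m T N B ->
  (forall u, J u -> is_vDerive g u (vadd (vscal x (T u)) (vscal y (B u)))) ->
  x - m * y <> 0 -> bertrand_curve J g.
Proof.
intros HJ HF Hg Hn.
assert (Hm : 0 < 1 + m * m) by (generalize (Rle_0_sqr m); unfold Rsqr; lra).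
(* Passing from [g] to [g + mu N] lowers [x - m y] by [mu (1 + m m)]; a decrease of [2 (x - m y)]
   reverses its sign. *)
set (mu := 2 * (x - m * y) / (1 + m * m)).
assert (Hmu : mu <> 0).
{ unfold mu, Rdiv; repeat apply Rmult_integral_contrapositive_currified;
    [lra | exact Hn | apply Rinv_neq_0_compat; lra]. }
set (h := fun u => vadd (g u) (vscal mu (N u))).
assert (Hh : forall u, J u ->
  is_vDerive h u (vadd (vscal (x - mu) (T u)) (vscal (y + mu * m) (B u)))).
{ intros u Ju; destruct (HF u Ju) as [_ [_ [_ [_ [_ [K _]]]]]].
  eapply is_vDerive_eq.
  - apply is_vDerive_add; [exact (Hg u Ju) | apply is_vDerive_scal_const, K].
  - vec_ring. }
assert (Hn' : x - mu - m * (y + mu * m) <> 0).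
{ replace (x - mu - m * (y + mu * m)) with (- (x - m * y)).
  - now apply Ropp_neq_0_compat.
  - unfold mu; field; lra. }
split; [exact (frame_curve_frenet J m T N B x y g HJ HF Hg Hn) |].
exists h; split; [exact (frame_curve_frenet J m T N B _ _ h HJ HF Hh Hn') |].
intros t Jt; split.
(* Coincident points would give [mu N = 0], whereas the norm of [mu N] is [Rabs mu]. *)
- intros E; destruct (HF t Jt) as [_ [H _]].
  assert (Z : vscal mu (N t) = (0, 0, 0)).
  { transitivity (vadd (h t) (vscal (-1) (g t))); [unfold h | rewrite E]; vec_ring. }
  assert (Z' := vnorm_scal_unit mu (N t) H).
  rewrite Z in Z'; unfold vnorm, dot, vx, vy, vz in Z'; simpl in Z'.
  replace (0 * 0 + 0 * 0 + 0 * 0) with 0 in Z' by ring.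
  rewrite sqrt_0 in Z'; now apply (Rabs_no_R0 mu).
- intros p.
  rewrite (frame_curve_normal_line J m T N B x y g t p HJ HF Hg Hn Jt).
  rewrite (frame_curve_normal_line J m T N B _ _ h t p HJ HF Hh Hn' Jt).
  unfold h; split; intros [z ->].
  + exists (z - mu); vec_ring.
  + exists (z + mu); vec_ring.
Qed.

(** * The frame of a unit speed helix *)

(** Multiplying [V] by the Gram determinant of [T] and [N], here equal to 1, gives an expansion that
    is a polynomial identity for arbitrary vectors; orthonormality then simplifies its
    coefficients. *)
Lemma frame_expansion (T N V : vec) :
  dot T T = 1 -> dot N N = 1 -> dot T N = 0 ->
  V = vadd (vadd (vscal (dot V T) T) (vscal (dot V N) N))
           (vscal (dot V (cross T N)) (cross T N)).
Proof.
intros HT HN H.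
transitivity (vscal (dot T T * dot N N - dot T N * dot T N) V);
  [rewrite HT, HN, H; vec_ring |].
transitivity (vadd (vadd (vscal (dot V T) (vadd (vscal (dot N N) T) (vscal (- dot T N) N)))
                   (vscal (dot V N) (vadd (vscal (dot T T) N) (vscal (- dot T N) T))))
           (vscal (dot V (cross T N)) (cross T N))); [vec_ring |].
rewrite HT, HN, H; vec_ring.
Qed.

Section UnitSpeed.

Variables (I : R -> Prop) (alpha : R -> vec).
Hypothesis alpha_frenet : frenet_curve I alpha.
Hypothesis alpha_unit : unit_speed I alpha.

Let I_open : open I := proj1 (proj2 (proj1 alpha_frenet)).
(** Derivatives are computed on [A1], whose components are plain [Derive] terms covered by the
    smoothness hypothesis, and then carried over to [tangent alpha], known to equal it on [I]. *)
Let A1 := vDerive alpha.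
Let A2 := vDerive A1.

Lemma unit_speed_derivatives (t : R) :
  I t -> is_vDerive A1 t (A2 t) /\ is_vDerive A2 t (vDerive A2 t).
Proof.
intros It; destruct (proj2 alpha_frenet) as [Cx [Cy [Cz _]]].
destruct (C3_on_derivatives _ _ t Cx It) as [_ [X2 X3]].
destruct (C3_on_derivatives _ _ t Cy It) as [_ [Y2 Y3]].
destruct (C3_on_derivatives _ _ t Cz It) as [_ [Z2 Z3]].
split; (split; [| split]; assumption).
Qed.

Lemma unit_speed_arcDerive (F : R -> vec) (t : R) :
  I t -> arcDerive alpha F t = vDerive F t.
Proof.
intros It; unfold arcDerive; rewrite (alpha_unit t It), Rinv_1; vec_ring.
Qed.

Lemma unit_speed_tangent (t : R) : I t -> tangent alpha t = A1 t.
Proof. exact (unit_speed_arcDerive alpha t). Qed.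

Lemma unit_speed_tangent_vDerive (t : R) : I t -> vDerive (tangent alpha) t = A2 t.
Proof.
intros It; apply is_vDerive_unique.
apply (is_vDerive_ext_on I A1); [exact I_open | exact It | |].
- intros u Iu; symmetry; exact (unit_speed_tangent u Iu).
- exact (proj1 (unit_speed_derivatives t It)).
Qed.

(** The right-hand side is the integrand of [indicatrix_arclength], so sigma has derivative
    kappa. *)
Lemma unit_speed_curvature (t : R) :
  I t -> curvature alpha t = vnorm (vDerive (tangent alpha) t).
Proof. now intros It; unfold curvature; rewrite unit_speed_arcDerive. Qed.

Lemma unit_speed_curvature_sqr (t : R) :
  I t -> 0 < curvature alpha t /\ 0 < dot (A2 t) (A2 t) /\
    curvature alpha t * curvature alpha t = dot (A2 t) (A2 t).
Proof.
intros It.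
assert (K : curvature alpha t <> 0) by now apply alpha_frenet.
rewrite unit_speed_curvature, unit_speed_tangent_vDerive in * by assumption.
unfold vnorm in *.
(* [sqrt] is 0 on non-positive arguments, so a non-zero norm forces a positive radicand. *)
destruct (Rle_lt_dec (dot (A2 t) (A2 t)) 0) as [L | L].
- now rewrite (sqrt_neg_0 _ L) in K.
- split; [now apply sqrt_lt_R0 | split; [exact L | apply sqrt_sqrt; lra]].
Qed.

(** Nonvanishing curvature keeps the radicand positive, where [sqrt] is differentiable. This serves
    both to differentiate the normal and to make the integrand of sigma continuous. *)
Lemma unit_speed_curvature_derive (t : R) :
  I t -> exists l, is_derive (curvature alpha) t l.
Proof.
intros It; eexists.
apply (is_derive_ext_on I (fun u => vnorm (A2 u))); [exact I_open | exact It | |].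
- intros u Iu; now rewrite unit_speed_curvature, unit_speed_tangent_vDerive.
- destruct (unit_speed_derivatives t It) as [_ D].
  apply is_derive_sqrt; [exact (is_derive_dot _ _ _ _ _ D D) |].
  apply (unit_speed_curvature_sqr t It).
Qed.

Lemma unit_speed_normal (t : R) :
  I t -> normal alpha t = vscal (/ curvature alpha t) (A2 t).
Proof.
intros It; unfold normal.
now rewrite unit_speed_arcDerive, unit_speed_tangent_vDerive.
Qed.

Lemma unit_speed_orthonormal (t : R) :
  I t -> dot (tangent alpha t) (tangent alpha t) = 1 /\
    dot (normal alpha t) (normal alpha t) = 1 /\
    dot (tangent alpha t) (normal alpha t) = 0.
Proof.
intros It.
assert (U : forall u, I u -> dot (A1 u) (A1 u) = 1).
{ intros u Iu; assert (S := alpha_unit u Iu); unfold speed, vnorm in S.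
  fold A1 in S; destruct (Rle_lt_dec (dot (A1 u) (A1 u)) 0) as [L | L].
  - rewrite (sqrt_neg_0 _ L) in S; lra.
  - rewrite <- (sqrt_sqrt (dot (A1 u) (A1 u))) by lra; rewrite S; ring. }
destruct (unit_speed_curvature_sqr t It) as [K [_ S]].
rewrite unit_speed_tangent, unit_speed_normal by assumption.
split; [now apply U | split].
- replace (dot (vscal (/ curvature alpha t) (A2 t)) (vscal (/ curvature alpha t) (A2 t)))
    with (/ curvature alpha t * / curvature alpha t * dot (A2 t) (A2 t))
    by (unfold dot, vscal, vx, vy, vz; simpl; ring).
  rewrite <- S; field; lra.
- destruct (unit_speed_derivatives t It) as [D _].
  (* Differentiating [A1 . A1 = 1] gives [A1 . A2 = 0]. *)
  assert (Z := is_derive_const_on I _ 1 t _ I_open It U (is_derive_dot _ _ _ _ _ D D)).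
  transitivity (/ curvature alpha t * / 2 * (dot (A2 t) (A1 t) + dot (A1 t) (A2 t))).
  + unfold dot, vscal, vx, vy, vz; simpl; field; lra.
  + rewrite Z; ring.
Qed.

Lemma tangent_derive (t : R) :
  I t -> is_vDerive (tangent alpha) t (vscal (curvature alpha t) (normal alpha t)).
Proof.
intros It.
apply (is_vDerive_ext_on I A1); [exact I_open | exact It | |].
- intros u Iu; symmetry; exact (unit_speed_tangent u Iu).
- eapply is_vDerive_eq; [exact (proj1 (unit_speed_derivatives t It)) |].
  rewrite unit_speed_normal by assumption.
  assert (K := proj1 (unit_speed_curvature_sqr t It)).
  apply vec_eq; unfold vscal, vx, vy, vz; simpl; field; lra.
Qed.

(** The normal is [A2] divided by the curvature, hence has a derivative [W]. Its components in the
    frame come from differentiating the orthonormality relations and from the definition of torsion;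
    the product rule then gives [B']. *)
Lemma normal_binormal_derive (t : R) :
  I t ->
  is_vDerive (normal alpha) t
    (vadd (vscal (- curvature alpha t) (tangent alpha t))
          (vscal (torsion alpha t) (binormal alpha t))) /\
  is_vDerive (binormal alpha) t (vscal (- torsion alpha t) (normal alpha t)).
Proof.
intros It.
destruct (unit_speed_curvature_sqr t It) as [K _].
assert (DN : exists W, is_vDerive (normal alpha) t W).
{ destruct (unit_speed_curvature_derive t It) as [l D].
  eexists; apply (is_vDerive_ext_on I (fun u => vscal (/ curvature alpha u) (A2 u)));
    [exact I_open | exact It | |].
  - intros u Iu; symmetry; exact (unit_speed_normal u Iu).
  - apply is_vDerive_scal; [| exact (proj2 (unit_speed_derivatives t It))].
    apply is_derive_inv; [exact D | lra]. }
destruct DN as [W DN].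
assert (DT := tangent_derive t It).
assert (O := unit_speed_orthonormal).
destruct (O t It) as [HT [HN H]].
assert (WN := is_derive_const_on I _ 1 t _ I_open It
  (fun u Iu => proj1 (proj2 (O u Iu))) (is_derive_dot _ _ _ _ _ DN DN)).
assert (WT := is_derive_const_on I _ 0 t _ I_open It
  (fun u Iu => proj2 (proj2 (O u Iu))) (is_derive_dot _ _ _ _ _ DT DN)).
assert (DB := is_vDerive_cross _ _ _ _ _ DT DN).
(* In [B' = T' x N + T x W] the first term contributes nothing to [B' . N], and
   [- (T x W) . N = W . (T x N)]. *)
assert (TW : torsion alpha t = dot W (binormal alpha t)).
{ unfold torsion; rewrite unit_speed_arcDerive by assumption.
  change (binormal alpha) with (fun u => cross (tangent alpha u) (normal alpha u)).
  rewrite (is_vDerive_unique _ _ _ DB).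
  unfold dot, vadd, vscal, cross, vx, vy, vz; simpl; ring. }
assert (E : W = vadd (vscal (- curvature alpha t) (tangent alpha t))
          (vscal (torsion alpha t) (binormal alpha t))).
{ rewrite (frame_expansion (tangent alpha t) (normal alpha t) W) at 1 by assumption.
  fold (binormal alpha t); rewrite <- TW.
  replace (dot W (tangent alpha t)) with (- curvature alpha t).
  - replace (dot W (normal alpha t)) with 0; [vec_ring |].
    replace (dot (normal alpha t) W) with (dot W (normal alpha t)) in WN
      by (unfold dot; ring).
    lra.
  - replace (dot (vscal (curvature alpha t) (normal alpha t)) (normal alpha t))
      with (curvature alpha t * dot (normal alpha t) (normal alpha t)) in WT
      by (unfold dot, vscal, vx, vy, vz; simpl; ring).
    rewrite HN in WT.
    replace (dot W (tangent alpha t)) with (dot (tangent alpha t) W)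
      by (unfold dot; ring).
    lra. }
split; [now rewrite <- E |].
eapply is_vDerive_eq; [exact DB |].
rewrite E; unfold binormal.
transitivity (vscal (torsion alpha t)
  (vadd (vscal (dot (tangent alpha t) (normal alpha t)) (tangent alpha t))
        (vscal (- dot (tangent alpha t) (tangent alpha t)) (normal alpha t)))).
- vec_ring.
- rewrite HT, H; vec_ring.
Qed.

(* Differentiating [T . u = cos phi] gives [N . u = 0], and then
   [kappa cos phi = tau (B . u)] where [B . u] is constant; it cannot vanish,
   since otherwise [u] would be orthogonal to the whole frame. *)
Lemma helix_torsion_curvature_ratio :
  general_helix I alpha ->
  exists m, forall t, I t -> torsion alpha t = m * curvature alpha t.
Proof.
intros [_ [u [phi [Hu Hphi]]]].
assert (HI := proj1 alpha_frenet).
destruct (proj1 HI) as [t0 I0].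
assert (DT : forall t, I t -> is_derive (fun r => dot (tangent alpha r) u) t
  (curvature alpha t * dot (normal alpha t) u)).
{ intros t It; eapply is_derive_eq.
  - exact (is_derive_dot _ _ t _ _ (tangent_derive t It) (is_vDerive_const u t)).
  - unfold dot, vscal, vx, vy, vz; simpl; ring. }
assert (HN : forall t, I t -> dot (normal alpha t) u = 0).
{ intros t It; assert (Z := is_derive_const_on I _ _ t _ I_open It Hphi (DT t It)).
  apply Rmult_integral in Z; destruct Z as [Z | Z]; [| exact Z].
  generalize (proj1 (unit_speed_curvature_sqr t It)); lra. }
assert (HB : forall t, I t ->
  torsion alpha t * dot (binormal alpha t) u = curvature alpha t * cos phi).
{ intros t It.
  assert (Z := is_derive_const_on I _ _ t _ I_open It HN
    (is_derive_dot _ _ t _ _ (proj1 (normal_binormal_derive t It)) (is_vDerive_const u t))).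
  rewrite <- (Hphi t It), <- (Rplus_0_r (_ * dot (tangent _ _) _)), <- Z.
  unfold dot, vadd, vscal, vx, vy, vz; simpl; ring. }
(* The derivative of [B . u] is [- tau (N . u) = 0]. *)
assert (CB : forall t, I t -> dot (binormal alpha t) u = dot (binormal alpha t0) u).
{ intros t It.
  destruct (mean_value_on I (fun r => dot (binormal alpha r) u) (fun _ => 0) t0 t)
    as [c [_ E]]; auto; [| lra].
  intros r Ir; eapply is_derive_eq.
  - exact (is_derive_dot _ _ r _ _ (proj2 (normal_binormal_derive r Ir))
      (is_vDerive_const u r)).
  - transitivity (- torsion alpha r * dot (normal alpha r) u).
    + unfold dot, vscal, vx, vy, vz; simpl; ring.
    + rewrite (HN r Ir); ring. }
set (q := dot (binormal alpha t0) u) in *.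
assert (Hq : q <> 0).
{ intros Z.
  assert (Zc : cos phi = 0).
  { assert (E := HB t0 I0); fold q in E; rewrite Z, Rmult_0_r in E.
    symmetry in E; apply Rmult_integral in E; destruct E as [E | E]; [| exact E].
    generalize (proj1 (unit_speed_curvature_sqr t0 I0)); lra. }
  destruct (unit_speed_orthonormal t0 I0) as [OT [ON O]].
  assert (C : forall V W, dot V W = dot W V) by (intros; unfold dot; ring).
  assert (E := frame_expansion _ _ u OT ON O).
  fold (binormal alpha t0) in E.
  rewrite (C u (tangent _ _)), (C u (normal _ _)), (C u (binormal _ _)) in E.
  rewrite Hphi, Zc, HN in E by assumption; fold q in E; rewrite Z in E.
  (* All three frame coefficients of [u] are now 0, against its unit length. *)
  assert (Eu : u = vscal 0 u) by (rewrite E at 1; vec_ring).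
  rewrite Eu in Hu; unfold vnorm in Hu.
  replace (dot (vscal 0 u) (vscal 0 u)) with 0 in Hu
    by (unfold dot, vscal, vx, vy, vz; simpl; ring).
  rewrite sqrt_0 in Hu; lra. }
exists (cos phi / q); intros t It.
assert (E := HB t It); rewrite CB in E by assumption.
apply (Rmult_eq_reg_r q); [rewrite E; field |]; exact Hq.
Qed.

(** The fundamental theorem of calculus; the integral starts at 0, whence [I 0]. *)
Lemma indicatrix_arclength_derive (t : R) :
  I 0 -> I t -> is_derive (indicatrix_arclength alpha) t (curvature alpha t).
Proof.
intros I0 It; rewrite unit_speed_curvature by assumption.
apply (is_derive_RInt_on I (fun u => vnorm (vDerive (tangent alpha) u)));
  [exact (proj1 alpha_frenet) | | exact I0 | exact It].
intros u Iu; destruct (unit_speed_curvature_derive u Iu) as [l D].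
apply is_derive_continuous with l.
apply (is_derive_ext_on I (curvature alpha)); auto.
exact unit_speed_curvature.
Qed.

End UnitSpeed.

(** The inverse [s] has derivative 1/kappa, so the chain rule divides the Frenet equations by kappa,
    and [tau = m kappa] leaves constant coefficients. *)
Lemma indicatrix_helix_frame (I : R -> Prop) (alpha : R -> vec) (s : R -> R) (m : R) :
  frenet_curve I alpha -> unit_speed I alpha -> I 0 ->
  (forall t, I t -> s (indicatrix_arclength alpha t) = t) ->
  (forall t, I t -> torsion alpha t = m * curvature alpha t) ->
  helix_frame (indicatrix_domain I alpha) m (fun u => tangent alpha (s u))
    (fun u => normal alpha (s u)) (fun u => binormal alpha (s u)).
Proof.
intros HF HU I0 HK Hm y [t [It <-]].
assert (K : forall r, I r -> 0 < curvature alpha r).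
{ intros r Ir; apply (unit_speed_curvature_sqr I alpha HF HU r Ir). }
assert (Ds := is_derive_inverse I (indicatrix_arclength alpha) (curvature alpha) s
  (proj1 HF) (fun r => indicatrix_arclength_derive I alpha HF HU r I0) K HK t It).
assert (DT := tangent_derive I alpha HF HU t It).
destruct (normal_binormal_derive I alpha HF HU t It) as [DN DB].
destruct (unit_speed_orthonormal I alpha HF HU t It) as [HT [HN H]].
assert (Kt := K t It).
rewrite Hm in DN, DB by assumption.
(* The chain rule expects the derivatives at the point [s (indicatrix_arclength alpha t)]. *)
rewrite <- (HK t It) in DT, DN, DB.
rewrite (HK t It).
split; [exact HT | split; [exact HN | split; [exact H | split; [reflexivity |]]]].
split; [| split]; (eapply is_vDerive_eq; [apply is_vDerive_comp; eassumption |]);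
  rewrite (HK t It); generalize (tangent alpha t) (normal alpha t) (binormal alpha t);
  intros; apply vec_eq; unfold vadd, vscal, vx, vy, vz; simpl; field; lra.
Qed.

(** The torsion of [gamma_T] is a non-zero multiple of [m + cot theta]. If this vanishes, the curve
    is an arc of a circle, with torsion 0; the premise of the second half excludes that case. As
    [tau + cot theta kappa = (m + cot theta) kappa], one parameter value is enough to test it. *)
Theorem corollary2 (I : R -> Prop) (alpha : R -> vec) (s : R -> R)
    (a theta sigma0 : R) (c : vec)
    (I_0 : I 0)
    (alpha_unit : unit_speed I alpha)
    (alpha_helix : general_helix I alpha)
    (s_inverse : forall t, I t -> s (indicatrix_arclength alpha t) = t)
    (sigma0_in : indicatrix_domain I alpha sigma0)
    (cot_defined : sin theta <> 0)
    (gamma_regular : regular_on (indicatrix_domain I alpha)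
                       (gamma_T alpha s a theta sigma0 c))
    (gamma_curved : curved_on (indicatrix_domain I alpha)
                      (gamma_T alpha s a theta sigma0 c)) :
  bertrand_curve (indicatrix_domain I alpha)
    (gamma_T alpha s a theta sigma0 c) /\
  ((exists t, I t /\ torsion alpha t + cot theta * curvature alpha t <> 0) ->
   circular_helix (indicatrix_domain I alpha)
     (gamma_T alpha s a theta sigma0 c)).
Proof.
assert (HF := proj1 alpha_helix).
destruct (helix_torsion_curvature_ratio I alpha HF alpha_unit alpha_helix) as [m Hm].
assert (frame := indicatrix_helix_frame I alpha s m HF alpha_unit I_0 s_inverse Hm).
assert (HJ : Defs.open_interval (indicatrix_domain I alpha)).
{ apply (image_open_interval I (indicatrix_arclength alpha) (curvature alpha)).
  - exact (proj1 HF).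
  - intros t It; exact (indicatrix_arclength_derive I alpha HF alpha_unit t I_0 It).
  - intros t It; apply (unit_speed_curvature_sqr I alpha HF alpha_unit t It). }
set (J := indicatrix_domain I alpha) in *.
set (g := gamma_T alpha s a theta sigma0 c) in *.
assert (Hg : forall u, J u -> is_vDerive g u
  (vadd (vscal a (tangent alpha (s u))) (vscal (a * cot theta) (binormal alpha (s u))))).
{ intros u Ju; eapply is_vDerive_eq.
  - apply is_vDerive_add; [| apply is_vDerive_const].
    apply is_vDerive_add; apply is_vDerive_scal_const.
    + refine (is_vDerive_vRInt J _ sigma0 u HJ _ sigma0_in Ju).
      intros r Jr; destruct (frame r Jr) as [_ [_ [_ [_ [D _]]]]]; eexists; exact D.
    + refine (is_vDerive_vRInt J _ sigma0 u HJ _ sigma0_in Ju).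
      intros r Jr; destruct (frame r Jr) as [_ [_ [_ [_ [_ [_ D]]]]]]; eexists; exact D.
  - vec_ring. }
assert (Hn := frame_curve_nondegenerate J m _ _ _ _ _ g HJ frame Hg sigma0 sigma0_in
  (gamma_curved sigma0 sigma0_in)).
split; [exact (frame_curve_bertrand J m _ _ _ _ _ g HJ frame Hg Hn) |].
intros [t [It Ht]].
apply (frame_curve_circular_helix J m _ _ _ _ _ g HJ frame Hg Hn).
intros Z.
(* For [a = 0] both coordinates [a] and [a * cot theta] would vanish, against nondegeneracy. *)
assert (Ha : a <> 0) by (intros E; apply Hn; rewrite E; ring).
apply Ht; rewrite (Hm t It); apply (Rmult_eq_reg_l a); [| exact Ha].
transitivity ((m * a + a * cot theta) * curvature alpha t); [ring |].
rewrite Z; ring.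
Qed.
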